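(* The total span complexity of dSMC with $N$ particles for $T+1$ time steps $0,1,\dots,T$, run on a balanced binary tree obtained by recursive midpoint splitting, is $O(\log_2(T)\log_2(N))$.
   Context: Span complexity is the parallel running time (length of the longest chain of dependent elementary operations) on a parallel machine with as many processors as needed. Sampling from a proposal distribution, evaluating a density ratio, and evaluating a weight function at a given pair of states are elementary operations of unit cost. dSMC (de-Sequentialized Monte Carlo) is the following algorithm. Data: a state space $\mathcal{X}$, Markov kernels $P_t(\mathrm{d}x_t\mid x_{t-1})$, $t=1,\dots,T$, an initial distribution $\mathbb{P}_0$, nonnegative potentials $h_t$, proposal probability measures $q_t$ and auxiliary probability measures $\nu_t$ on $\mathcal{X}$ for $t=0,\dots,T$ (with $\nu_0\propto h_0\mathbb{P}_0$), and weight functions given by the Radon–Nikodym derivatives $\omega_c(x_{c-1},x_c)=P_c(\mathrm{d}x_c\mid x_{c-1})h_c(x_c)/\nu_c(\mathrm{d}x_c)$. Initialization: for all $t=0,\dots,T$ in parallel, sample $X_t^1,\dots,X_t^N$ from $q_t$, compute their importance weights (density of $\nu_t$, up to a constant for $t=0$, with respect to $q_t$ at each sample), normalize them to get $w_t^{1:N}$, and record their mean as a normalizing constant estimate $L^N_{t:t}$. Recursion: a balanced binary tree is put on $\{0,\dots,T\}$ by recursively splitting intervals $a:b$ into $a:c-1$ and $c:b$ at their midpoint until singletons are reached; its depth is $O(\log_2 T)$. All nodes at the same depth are processed in parallel, from the leaves to the root. Processing a node $a:b$ with children $a:c-1$ and $c:b$, having weighted particle trajectories $(X^{1:N}_{a:c-1},w^{1:N}_{c-1})$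 and $(X^{1:N}_{c:b},w_c^{1:N})$ (with weights equal to $1/N$ at non-leaf children) and normalizing constant estimates $L^N_{a:c-1}$, $L^N_{c:b}$, consists in: computing the $N^2$ weights $\omega_c(X^m_{c-1},X^n_c)w^m_{c-1}w^n_c$ in parallel; computing their sum $L_c^N$ and normalizing; drawing $N$ pairs of indices $(l_n,r_n)\in\{1,\dots,N\}^2$ according to the normalized weights, by a resampling method implemented in parallel via prefix sums and searches; setting, in parallel over $n$ and time indices, the new trajectories to $[X^{l_n}_{a:c-1},X^{r_n}_{c:b}]$ (concatenation); and returning these with the estimate $L^N_{a:b}=L^N_{a:c-1}L^N_{c:b}L^N_c$. *)

(* Defs.v *)
From mathcomp Require Import all_boot all_order all_algebra.
From mathcomp Require Import all_classical all_reals all_analysis.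

Set Implicit Arguments.
Unset Strict Implicit.
Unset Printing Implicit Defensive.

Import Order.TTheory GRing.Theory Num.Theory.

Local Open Scope ring_scope.

(** Families are indexed by [nat]; only the times [0, ..., T] (and [1, ..., T]
    for [ker] and [omega]) are constrained and used.  Radon-Nikodym derivatives
    are given by arbitrary versions, characterised by their integrals. *)

Record smc_model d (X : measurableType d) (R : realType) (T : nat) := SmcModel {
  init : probability X R;
  ker : nat -> R.-pker X ~> X;
  pot : nat -> X -> R;
  prop : nat -> probability X R;
  aux : nat -> probability X R;
  (* density of [aux t] (up to a constant when [t = 0]) w.r.t. [prop t] *)
  eta : nat -> X -> R;
  (* [omega c x y] is the density of [ker c x (dy) * pot c y] w.r.t. [aux c] *)
  omega : nat -> X -> X -> R;
  pot_ge0 : forall t x, (t <= T)%N -> 0 <= pot t x;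
  pot_meas : forall t, (t <= T)%N -> measurable_fun setT (pot t);
  aux0_prop : exists2 Z : R, 0 < Z & forall A, measurable A ->
    (\int[init]_(x in A) (pot 0 x)%:E = Z%:E * aux 0 A)%E;
  eta_ge0 : forall t x, (t <= T)%N -> 0 <= eta t x;
  eta_meas : forall t, (t <= T)%N -> measurable_fun setT (eta t);
  eta0_density : exists2 c : R, 0 < c & forall A, measurable A ->
    (\int[prop 0]_(x in A) (eta 0 x)%:E = c%:E * aux 0 A)%E;
  eta_density : forall t, (0 < t <= T)%N -> forall A, measurable A ->
    (\int[prop t]_(x in A) (eta t x)%:E = aux t A)%E;
  omega_ge0 : forall c x y, (0 < c <= T)%N -> 0 <= omega c x y;
  omega_meas : forall c x, (0 < c <= T)%N -> measurable_fun setT (omega c x);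
  omega_density : forall c x, (0 < c <= T)%N -> forall A, measurable A ->
    (\int[aux c]_(y in A) (omega c x y)%:E
     = \int[ker c x]_(y in A) (pot c y)%:E)%E
}.

(** Standard resampling schemes, which differ only in how the [N] points at
    which the inverse cumulative distribution is evaluated are produced. *)
Variant resampling := Multinomial | Stratified | Systematic.

(** An [N * N] array indexed by pairs is stored in row-major order. *)

Lemma row_subproof N (j : 'I_(N * N)) : (j %/ N < N)%N.
Proof.
case: N j => [|N] j; first by case: j.
by rewrite ltn_divLR.
Qed.

Lemma col_subproof N (j : 'I_(N * N)) : (j %% N < N)%N.
Proof.
case: N j => [|N] j; first by case: j.
by rewrite ltn_mod.
Qed.

Lemma mid_subproof k (i j : 'I_k) : ((i + j)./2 < k)%N.
Proof.
rewrite -divn2 ltn_divLR // muln2 -addnn.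
by rewrite -addSn leq_add // ltnW.
Qed.

Lemma first_subproof N (n : 'I_N) : (0 < N * N)%N.
Proof. by case: N n => [[]|]. Qed.

Definition pair_row N (j : 'I_(N * N)) : 'I_N := Ordinal (row_subproof j).
Definition pair_col N (j : 'I_(N * N)) : 'I_N := Ordinal (col_subproof j).
Definition mid_addr k (i j : 'I_k) : 'I_k := Ordinal (mid_subproof i j).
Definition next_addr k (i : 'I_k) : 'I_k := insubd i i.+1.
(* [i - s]; meant for [s <= i] *)
Definition back s k (i : 'I_k) : 'I_k :=
  Ordinal (leq_ltn_trans (leq_subr s i) (ltn_ord i)).
(* the extremal addresses of an array of size [N * N], which is nonempty
   because ['I_N] is inhabited by [n] *)
Definition first_pair N (n : 'I_N) : 'I_(N * N) := Ordinal (first_subproof n).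
Definition last_pair N (n : 'I_N) : 'I_(N * N) := rev_ord (first_pair n).

Section Machine.
Context d (X : measurableType d) (R : realType) (T : nat).
Variable M : smc_model X R T.

Inductive op : Type -> Type :=
| Sample d' (Y : measurableType d') (mu : probability Y R) : op Y
| Density (t : nat) (x : X) : op R
| Weight (c : nat) (x y : X) : op R
| Add (x y : R) : op R
| Mul (x y : R) : op R
| Div (x y : R) : op R
| Leq (x y : R) : op bool
| Fetch (I : finType) (A : Type) (mem : I -> A) (i : I) : op A
| RowOf N (j : 'I_(N * N)) : op 'I_N
| ColOf N (j : 'I_(N * N)) : op 'I_N
| Midpoint k (i j : 'I_k) : op 'I_k
| Next k (i : 'I_k) : op 'I_k.

(** Possible results of an operation: any point for a sampling operation. *)
Definition outcome A (o : op A) : A -> Prop :=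
  match o in op A return A -> Prop with
  | Sample _ _ _ => fun _ => True
  | Density t x => fun r => r = eta M t x
  | Weight c x y => fun r => r = omega M c x y
  | Add x y => fun r => r = x + y
  | Mul x y => fun r => r = x * y
  | Div x y => fun r => r = x / y
  | Leq x y => fun r => r = (x <= y)
  | Fetch _ _ mem i => fun r => r = mem i
  | RowOf _ j => fun r => r = pair_row j
  | ColOf _ j => fun r => r = pair_col j
  | Midpoint _ i j => fun r => r = mid_addr i j
  | Next _ i => fun r => r = next_addr i
  end.

Inductive prog : Type -> Type :=
| Ret A (a : A) : prog A
| Op A (o : op A) : prog A
| Bind A B (p : prog A) (f : A -> prog B) : prog B
| Fork (I : finType) A (p : I -> prog A) : prog (I -> A)
| Fork2 A B (p : prog A) (q : prog B) : prog (A * B).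

(** [run p a s]: some execution of [p] returns [a], and its longest chain of
    dependent operations has length [s].  In [Bind p f] all of [f a] depends on
    all of [p], whereas the branches of a fork are mutually independent. *)
Fixpoint run A (p : prog A) : A -> nat -> Prop :=
  match p in prog A return A -> nat -> Prop with
  | Ret _ a => fun b s => b = a /\ s = 0%N
  | Op _ o => fun b s => outcome o b /\ s = 1%N
  | Bind _ _ p f => fun b s =>
      exists a s1 s2, [/\ run p a s1, run (f a) b s2 & s = (s1 + s2)%N]
  | Fork _ _ p => fun b s =>
      exists2 s' : _ -> nat, forall i, run (p i) (b i) (s' i)
                           & s = (\max_i s' i)%N
  | Fork2 _ _ p q => fun b s =>
      exists s1 s2, [/\ run p b.1 s1, run q b.2 s2 & s = maxn s1 s2]
  end.

Definition span_complexity A (p : prog A) : \bar R :=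
  ereal_sup [set s%:R%:E | s in [set s | exists a, run p a s]]%classic.

(** The supremum above is never over the empty set. *)
Lemma run_total A (p : prog A) : exists a s, run p a s.
Proof.
elim: p => {A} [A a|A o|A B p [a [s1 r1]] f IHf|I A p IHp|A B p [a [s1 r1]] q
  [b [s2 r2]]] /=.
- by exists a, 0%N.
- case: o => /= *; try by eexists; exists 1%N.
  by exists point, 1%N.
- by have [b [s2 r2]] := IHf a; exists b, (s1 + s2)%N, a, s1, s2.
- have [b IHb] := choice IHp; have [s' Hs'] := choice IHb.
  by exists b, (\max_i s' i)%N, s'.
- by exists (a, b), (maxn s1 s2), s1, s2.
Qed.

Local Notation "x <- p ;; q" := (Bind p (fun x => q))
  (at level 100, p at level 99, right associativity).

(** Inclusive prefix sums (Hillis and Steele): in round [i], each entry of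
    address at least [2 ^ i] is incremented by the one [2 ^ i] places before. *)
Fixpoint scan_rounds k (m : nat) (a : 'I_k -> R) : prog ('I_k -> R) :=
  if m is m'.+1 then
    b <- scan_rounds m' a ;;
    Fork (fun j : 'I_k =>
      if (2 ^ m' <= j)%N then Op (Add (b (back (2 ^ m') j)) (b j))
      else Ret (b j))
  else Ret a.

Definition scan k (a : 'I_k -> R) : prog ('I_k -> R) :=
  scan_rounds (up_log 2 k) a.

(** The sum of an array is its last prefix sum. *)
Definition total k : ('I_k -> R) -> prog R :=
  if k is k'.+1 return ('I_k -> R) -> prog R
  then fun a => b <- scan a ;; Ret (b ord_max)
  else fun=> Ret 0.

(** Binary search in [lo, ..., hi] for the first address at which the
    nondecreasing array [a] is at least [u] ([hi] if there is none). *)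
Fixpoint search_rounds k (m : nat) (a : 'I_k -> R) (u : R) (lo hi : 'I_k) :
    prog 'I_k :=
  if m is m'.+1 then
    i <- Op (Midpoint lo hi) ;;
    v <- Op (Fetch a i) ;;
    b <- Op (Leq u v) ;;
    if b then search_rounds m' a u lo i
    else (i' <- Op (Next i) ;; search_rounds m' a u i' hi)
  else Ret hi.

Definition search k (a : 'I_k -> R) (u : R) (lo hi : 'I_k) : prog 'I_k :=
  search_rounds (up_log 2 k) a u lo hi.

Variables (N : nat) (scheme : resampling).

Definition unif : op R := Sample (uniform_prob (@ltr01 R)).

Definition points : prog ('I_N -> R) :=
  match scheme with
  | Multinomial => Fork (fun n : 'I_N => Op unif)
  | Stratified => Fork (fun n : 'I_N =>
      u <- Op unif ;; v <- Op (Add n%:R u) ;; Op (Div v N%:R))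
  | Systematic =>
      u <- Op unif ;;
      Fork (fun n : 'I_N => v <- Op (Add n%:R u) ;; Op (Div v N%:R))
  end.

Definition resample (w : 'I_(N * N) -> R) : prog ('I_N -> 'I_N * 'I_N) :=
  cum <- scan w ;;
  u <- points ;;
  Fork (fun n : 'I_N =>
    j <- search cum (u n) (first_pair n) (last_pair n) ;;
    l <- Op (RowOf j) ;;
    r <- Op (ColOf j) ;;
    Ret (l, r)).

(** Weighted trajectories over the times [start, ..., start + len], with a
    normalizing constant estimate.  [wgt] are the weights used when the node is
    a child. *)
Record cloud := Cloud {
  start : nat;
  len : nat;
  traj : 'I_N -> 'I_len.+1 -> X;
  wgt : 'I_N -> R;
  ncst : R
}.
Arguments traj : clear implicits.

Definition initialize (t : nat) : prog cloud :=
  x <- Fork (fun n : 'I_N => Op (Sample (prop M t))) ;;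
  e <- Fork (fun n : 'I_N => Op (Density t (x n))) ;;
  s <- total e ;;
  w <- Fork (fun n : 'I_N => Op (Div (e n) s)) ;;
  L <- Op (Div s N%:R) ;;
  Ret (@Cloud t 0 (fun n _ => x n) w L).

Definition merge (lc rc : cloud) : prog cloud :=
  let c := start rc in
  W <- Fork (fun j : 'I_(N * N) =>
    o <- Op (Weight c (traj lc (pair_row j) ord_max)
                      (traj rc (pair_col j) ord0)) ;;
    v <- Op (Mul o (wgt lc (pair_row j))) ;;
    Op (Mul v (wgt rc (pair_col j)))) ;;
  L <- total W ;;
  w <- Fork (fun j : 'I_(N * N) => Op (Div (W j) L)) ;;
  lr <- resample w ;;
  x <- Fork (fun n : 'I_N => Fork (fun i : 'I_((len lc).+1 + (len rc).+1) =>
    match fintype.split i with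
    | inl i => Op (Fetch (fun m => traj lc m i) (lr n).1)
    | inr i => Op (Fetch (fun m => traj rc m i) (lr n).2)
    end)) ;;
  w' <- Fork (fun n : 'I_N => Op (Div 1 N%:R)) ;;
  L' <- Op (Mul (ncst lc) (ncst rc)) ;;
  L'' <- Op (Mul L' L) ;;
  Ret (@Cloud (start lc) (len lc + (len rc).+1) x w' L'').

(** Interval tree some nodes of which have been processed. *)
Inductive itree := Done (k : cloud) | Pending (l r : itree).

Fixpoint depth (t : itree) : nat :=
  if t is Pending l r then (maxn (depth l) (depth r)).+1 else 0.

(** [a:b] is split into [a:c-1] and [c:b] with [c = ceil ((a + b) / 2)];
    [fuel >= b - a] suffices to reach all singletons. *)
Fixpoint split_tree (fuel : nat) (leaf : nat -> cloud) (a b : nat) : itree :=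
  match fuel with
  | fuel'.+1 =>
      if (a < b)%N then
        let c := uphalf (a + b) in
        Pending (split_tree fuel' leaf a c.-1) (split_tree fuel' leaf c b)
      else Done (leaf a)
  | 0 => Done (leaf a)
  end.

Fixpoint process_level (k : nat) (t : itree) : prog itree :=
  match k, t with
  | 0, Pending (Done lc) (Done rc) => x <- merge lc rc ;; Ret (Done x)
  | k'.+1, Pending l r =>
      lr <- Fork2 (process_level k' l) (process_level k' r) ;;
      Ret (Pending lr.1 lr.2)
  | _, _ => Ret t
  end.

(** Process the depths [k - 1], ..., [0], in that order. *)
Fixpoint sweep (k : nat) (t : itree) : prog itree :=
  if k is k'.+1 then t' <- process_level k' t ;; sweep k' t' else Ret t.

Definition dsmc : prog itree :=
  leaves <- Fork (fun t : 'I_T.+1 => initialize t) ;;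
  let tree := split_tree T (fun t => leaves (inord t)) 0 T in
  sweep (depth tree) tree.

Lemma process_level_depth k t t' s : run (process_level k t) t' s ->
  (depth t <= k.+1)%N -> (depth t' <= k)%N.
Proof.
elim: k t t' s => [|k IHk] [c|l r] t' s.
- by move=> /= [-> _].
- case: l r => [lc|? ?] [rc|? ?]; last 3 first.
  + by move=> _ /=; rewrite ltnS geq_max andbC.
  + by move=> _ /=; rewrite ltnS geq_max.
  + by move=> _ /=; rewrite ltnS geq_max.
  by move=> /= [a] [? [? [_ [-> _] _]]].
- by move=> /= [-> _].
- move=> /= [[l' r']] [? [? [[s1 [s2 [/= rl rr _]]] [-> _] _]]] /=.
  by rewrite !ltnS !geq_max => /andP[/(IHk _ _ _ rl) -> /(IHk _ _ _ rr) ->].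
Qed.

Lemma sweep_done k t t' s : run (sweep k t) t' s ->
  (depth t <= k)%N -> exists c, t' = Done c.
Proof.
elim: k t s => [|k IHk] t s /=.
  by move=> [-> _]; case: t => // c; exists c.
move=> [t1 [s1 [s2 [r1 r2 _]]]] tk.
exact: IHk r2 (process_level_depth r1 tk).
Qed.

(** The root has been processed when the algorithm ends. *)
Lemma dsmc_done t s : run dsmc t s -> exists c, t = Done c.
Proof. by move=> /= [? [? [? [_ /sweep_done + _]]]]; apply. Qed.

End Machine.

Definition log2 (R : realType) (n : nat) : R := ln n%:R / ln 2.

(* Main.v *)
Require Import Defs.
From mathcomp Require Import all_boot all_order all_algebra.
From mathcomp Require Import all_classical all_reals all_analysis.
From mathcomp Require Import zify ring lra.

(** A prefix sum over [k] entries and a binary search among them both take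
    [O(up_log 2 k)] dependent operations, so initializing a leaf costs
    [O(log N)] and merging two clouds, which works on [N * N] pair weights,
    costs [O(log (N * N)) = O(log N)].  Nodes of equal depth are independent,
    and midpoint splitting halves the intervals (rounding up), so the tree has
    depth at most [up_log 2 T.+1 = O(log T)]. *)

Import Order.TTheory GRing.Theory Num.Theory.

Local Open Scope ring_scope.

Section SpanBound.
Context {d : measure_display} {X : measurableType d} {R : realType} {T : nat}.
Variable M : smc_model X R T.

(** The bound ranges over every execution, whatever values are sampled, so it can be composed along
    [Bind] and forks. *)
Definition span_le {A} (p : prog X R A) (n : nat) : Prop :=
  forall a s, run M p a s -> (s <= n)%N.

Lemma span_leW {A} (p : prog X R A) m n :
  (m <= n)%N -> span_le p m -> span_le p n.
Proof. by move=> mn pm a s /pm sm; exact: leq_trans mn. Qed.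

Lemma span_le_ret {A} (a : A) n : span_le (Ret X R a) n.
Proof. by move=> b s /= [_ ->]. Qed.

Lemma span_le_op {A} (o : op X R A) : span_le (Op o) 1.
Proof. by move=> b s /= [_ ->]. Qed.

Lemma span_le_bind {A B} (p : prog X R A) (f : A -> prog X R B) m n :
  span_le p m -> (forall a, span_le (f a) n) -> span_le (Bind p f) (m + n).
Proof.
move=> pm fn b s /= [a [s1 [s2 [/pm s1m /fn s2n ->]]]].
exact: leq_add.
Qed.

Lemma span_le_fork {I : finType} {A} (p : I -> prog X R A) n :
  (forall i, span_le (p i) n) -> span_le (Fork p) n.
Proof. by move=> pn b s /= [s' rs ->]; apply/bigmax_leqP => i _; exact: pn. Qed.

Lemma span_le_fork2 {A B} (p : prog X R A) (q : prog X R B) n :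
  span_le p n -> span_le q n -> span_le (Fork2 p q) n.
Proof.
move=> pn qn b s /= [s1 [s2 [/pn s1n /qn s2n ->]]].
by rewrite geq_max s1n.
Qed.

Lemma span_le_bind_op {A B} (o : op X R A) (f : A -> prog X R B) n :
  (forall a, span_le (f a) n) -> span_le (Bind (Op o) f) n.+1.
Proof.
move=> fn; rewrite -add1n; apply: span_le_bind => //.
exact: span_le_op.
Qed.

Lemma span_le_fork_op {I : finType} {A} (o : I -> op X R A) :
  span_le (Fork (fun i => Op (o i))) 1.
Proof. by apply: span_le_fork => i; exact: span_le_op. Qed.

(** Each round is one layer of mutually independent additions, which lengthens the chain by one. *)
Lemma span_le_scan_rounds {k} m (a : 'I_k -> R) : span_le (scan_rounds X m a) m.
Proof.
elim: m => [|m IHm] /=; first exact: span_le_ret.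
rewrite -[m.+1]addn1; apply: span_le_bind => // b.
apply: span_le_fork => j; case: ifP => _.
  exact: span_le_op.
exact: span_le_ret.
Qed.

Lemma span_le_total {k} (a : 'I_k -> R) : span_le (Defs.total X a) (up_log 2 k).
Proof.
case: k a => [|k] a; first exact: span_le_ret.
rewrite -[up_log _ _]addn0; apply: span_le_bind => [|b].
  exact: span_le_scan_rounds.
exact: span_le_ret.
Qed.

(** A round computes a midpoint, fetches, compares and, only when it goes right, applies [Next]: at
    most four operations. *)
Lemma span_le_search_rounds {k} m (a : 'I_k -> R) u lo hi :
  span_le (search_rounds X m a u lo hi) (4 * m).
Proof.
elim: m lo hi => [|m IHm] lo hi; first exact: span_le_ret.
rewrite mulnS /=; do 3!apply: span_le_bind_op => ?.
case: ifP => _; last by apply: span_le_bind_op => ?.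
by apply: span_leW (IHm _ _); exact: leqnSn.
Qed.

(** The worst schemes are [Stratified] and [Systematic]: a draw, an addition, a division. *)
Lemma span_le_points N scheme : span_le (points X R N scheme) 3.
Proof.
case: scheme => /=.
- by apply: span_leW (span_le_fork_op _).
- apply: span_le_fork => n; do 2!apply: span_le_bind_op => ?.
  exact: span_le_op.
- apply: span_le_bind_op => u; apply: span_le_fork => n.
  by apply: span_le_bind_op => v; exact: span_le_op.
Qed.

Lemma span_le_resample N scheme (w : 'I_(N * N) -> R) :
  span_le (resample X scheme w)
    (up_log 2 (N * N) + (3 + (4 * up_log 2 (N * N) + 2))).
Proof.
apply: span_le_bind => [|cum]; first exact: span_le_scan_rounds.
apply: span_le_bind => [|u]; first exact: span_le_points.
apply: span_le_fork => n.
apply: span_le_bind => [|j]; first exact: span_le_search_rounds.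
by do 2!apply: span_le_bind_op => ?; exact: span_le_ret.
Qed.

Lemma span_le_initialize N t :
  span_le (initialize M N t) (1 + (1 + (up_log 2 N + (1 + 1)))).
Proof.
apply: span_le_bind => [|x]; first exact: span_le_fork_op.
apply: span_le_bind => [|e]; first exact: span_le_fork_op.
apply: span_le_bind => [|s]; first exact: span_le_total.
apply: span_le_bind => [|w]; first exact: span_le_fork_op.
by apply: span_le_bind_op => L; exact: span_le_ret.
Qed.

Lemma span_le_merge N scheme (lc rc : cloud X R N) :
  span_le (Defs.merge scheme lc rc) (6 * up_log 2 (N * N) + 13).
Proof.
(* the step costs of [merge], in program order *)
have -> U : (6 * U + 13
    = 3 + (U + (1 + ((U + (3 + (4 * U + 2))) + (1 + (1 + 2))))))%N by lia.
apply: span_le_bind => [|W].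
  apply: span_le_fork => j; do 2!apply: span_le_bind_op => ?.
  exact: span_le_op.
apply: span_le_bind => [|L]; first exact: span_le_total.
apply: span_le_bind => [|w]; first exact: span_le_fork_op.
apply: span_le_bind => [|lr]; first exact: span_le_resample.
apply: span_le_bind => [|x].
  apply: span_le_fork => n; apply: span_le_fork => i.
  by case: fintype.split => j; exact: span_le_op.
apply: span_le_bind => [|w']; first exact: span_le_fork_op.
by do 2!apply: span_le_bind_op => ?; exact: span_le_ret.
Qed.

(** The bound is free of [k] because [Fork2] takes a maximum: a whole level costs one merge. *)
Lemma span_le_process_level N scheme k (t : itree X R N) :
  span_le (process_level scheme k t) (6 * up_log 2 (N * N) + 13).
Proof.
elim: k t => [|k IHk] [c|l r]; try exact: span_le_ret.
- case: l r => [lc|? ?] [rc|? ?]; try exact: span_le_ret.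
  rewrite -[X in span_le _ X]addn0.
  apply: span_le_bind => [|x]; first exact: span_le_merge.
  exact: span_le_ret.
- rewrite -[X in span_le _ X]addn0.
  apply: span_le_bind => [|lr]; first exact: span_le_fork2.
  exact: span_le_ret.
Qed.

Lemma span_le_sweep N scheme k (t : itree X R N) :
  span_le (sweep scheme k t) (k * (6 * up_log 2 (N * N) + 13)).
Proof.
elim: k t => [|k IHk] t; first exact: span_le_ret.
by rewrite mulSn; apply: span_le_bind => // ?; exact: span_le_process_level.
Qed.

(** When [a < b], the [b - a + 1] times, at most [2 ^ k], split into halves that differ by at most
    one, so each half has at most [2 ^ k.-1] times. *)
Lemma depth_split_tree N k fuel (leaf : nat -> cloud X R N) a b :
  (b - a < 2 ^ k)%N -> (depth (split_tree fuel leaf a b) <= k)%N.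
Proof.
elim: k fuel a b => [|k IHk] [|fuel] a b bak //=; case: (ltnP a b) => //= ab.
  by rewrite expn0 in bak; lia.
(* [odd_double_half] makes the midpoint linear and [P] hides the power, which puts both halves
   within reach of [lia]. *)
rewrite ltnS geq_max uphalfE; have := odd_double_half (a + b).+1.
rewrite expnS in bak; move: bak IHk; set P := (2 ^ k)%N => bak IHk abE.
by apply/andP; split; apply: IHk; lia.
Qed.

Lemma span_le_dsmc N scheme :
  span_le (dsmc M N scheme)
    (up_log 2 N + 4 + up_log 2 T.+1 * (6 * up_log 2 (N * N) + 13)).
Proof.
apply: span_le_bind => [|leaves].
  apply: span_le_fork => t.
  by apply: span_leW (span_le_initialize _ _); lia.
apply: span_leW; last exact: span_le_sweep.
rewrite leq_mul2r; apply/orP; right; apply: depth_split_tree.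
(* [T < 2 ^ k] is [T.+1 <= 2 ^ k], hence the logarithm of the number of leaves. *)
by rewrite subn0; exact: up_logP.
Qed.

Lemma span_le_span_complexity {A} (p : prog X R A) n :
  span_le p n -> (span_complexity M p <= (n%:R : R)%:E)%E.
Proof.
move=> pn; apply: ge_ereal_sup => _ [s [a rs] <-].
by rewrite lee_fin ler_nat; exact: pn rs.
Qed.

End SpanBound.

(** The powers of [p] above [m] and [n] multiply to one above [m * n]. With [m = n = N], the pair
    arrays cost only twice the logarithm of [N]. *)
Lemma up_log_mul p m n : (1 < p)%N ->
  (up_log p (m * n) <= up_log p m + up_log p n)%N.
Proof.
by move=> p1; apply: up_log_min => //; rewrite expnD leq_mul ?up_logP.
Qed.

(** Since [n + 1 <= 2 n], one more doubling suffices; this passes from [T.+1] leaves to [T]. *)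
Lemma up_log2S_le n : (0 < n)%N -> (up_log 2 n.+1 <= (up_log 2 n).+1)%N.
Proof.
move=> n0; apply: up_log_min => //; rewrite expnS.
have := up_logP n (isT : 1 < 2)%N; lia.
Qed.

(** Rounding up adds at most 1 to the logarithm, and [1 <= log2 R n] absorbs it. *)
Lemma up_log2_le_log2 (R : realType) n : (2 <= n)%N ->
  (up_log 2 n)%:R <= 2 * log2 R n.
Proof.
move=> n2; have ln2_gt0 : 0 < ln 2 :> R by apply: ln_gt0; rewrite ltr1n.
have log2_ge k : (2 ^ k <= n)%N -> k%:R <= log2 R n.
  move=> kn; rewrite /log2 ler_pdivlMr // mulr_natl -lnXn ?ltr0n //.
  by rewrite ler_ln ?posrE ?exprn_gt0 ?ltr0n -?natrX ?ler_nat //; lia.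
have log2_ge1 : 1 <= log2 R n by exact: (log2_ge 1).
have /andP[/ltnW pn _] := up_log_bounds (isT : 1 < 2)%N n2.
have := log2_ge _ pn.
have -> : up_log 2 n = (up_log 2 n).-1.+1 by rewrite prednK // up_log_gt0.
by rewrite /= -natr1; lra.
Qed.

Theorem proposition2p4 (R : realType) :
  exists2 C : R, 0 < C &
    forall (d : measure_display) (X : measurableType d) (T N : nat)
           (M : smc_model X R T) (scheme : resampling),
      (2 <= T)%N -> (2 <= N)%N ->
      (span_complexity M (dsmc M N scheme) <= (C * (log2 R T * log2 R N))%:E)%E.
Proof.
(* [220 = 55 * 2 * 2]: for [t, u >= 1], [u + 4 <= 5 t u] and
   [(t + 1) (12 u + 13) <= 50 t u]; each rounded logarithm costs a factor 2. *)
exists 220 => // d X T N M scheme T2 N2.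
apply: le_trans (span_le_span_complexity M _ _ (span_le_dsmc M N scheme)) _.
rewrite lee_fin.
have t_gt0 : (0 < up_log 2 T)%N by rewrite up_log_gt0.
have u_gt0 : (0 < up_log 2 N)%N by rewrite up_log_gt0.
have tS := up_log2S_le T (ltnW T2).
have uM := up_log_mul 2 N N isT.
apply: (@le_trans _ _ (55 * (up_log 2 T * up_log 2 N))%:R).
  rewrite ler_nat.
  (* Monotonicity bounds the sweep by [(t + 1) * (6 * (u + u) + 13)], a polynomial in [t] and
     [u]. *)
  have := leq_mul tS (leq_add (leq_mul (leqnn 6) uM) (leqnn 13)).
  move: t_gt0 u_gt0; set t := up_log 2 T; set u := up_log 2 N; nia.
have -> : 220 * (log2 R T * log2 R N) = 55 * ((2 * log2 R T) * (2 * log2 R N)).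
  by ring.
rewrite !natrM ler_pM2l ?ltr0n //.
by rewrite ler_pM // up_log2_le_log2.
Qed.
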